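(* Let $G$ be a hyperbolic group, let $H_1$ be a quasiconvex subgroup of $G$, and let $H_2$ be an arbitrary subgroup of $G$. Suppose that $H_2$ is elementwise conjugate into $H_1$, i.e. for every $h\in H_2$ there exists $g\in G$ with $g^{-1}hg\in H_1$. Then there exists a finite index subgroup $A$ of $H_2$ which is conjugate into $H_1$, i.e. there exists $z\in G$ with $z^{-1}Az\leqslant H_1$.
   Context: Hyperbolic means (finitely generated and) word-hyperbolic in the sense of Gromov. A subgroup of a hyperbolic group is quasiconvex in the standard sense: it is a quasiconvex subset of the Cayley graph with respect to some (equivalently, any) finite generating set. *)

(* Defs.v *)
From mathcomp Require Import all_boot all_order all_algebra.
From mathcomp Require Import boolp classical_sets cardinality.

Set Implicit Arguments.
Unset Strict Implicit.
Unset Printing Implicit Defensive.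

Import Order.TTheory GRing.Theory Num.Theory.

Local Open Scope classical_set_scope.
Local Open Scope group_scope.

Definition subgroup (G : groupType) (H : set G) : Prop :=
  group_closed (mem H).

Definition generates (G : groupType) (S : seq G) : Prop :=
  forall K : set G, subgroup K -> [set` S] `<=` K -> K = setT.

(* The Cayley graph on the vertex set [G]: [x] is joined to [x * s] for [s] in
   [S] or in the set of inverses of [S]; edge paths are taken as sequences of
   vertices, in the sense of [path.path]. *)
Definition cayley_edge (G : groupType) (S : seq G) : rel G :=
  fun x y => (x^-1 * y \in S) || (y^-1 * x \in S).

Definition joined_in (G : groupType) (S : seq G) (x y : G) : pred nat :=
  fun n => `[< exists p : seq G,
    [/\ path (cayley_edge S) x p, last x p = y & size p = n] >].

(* The default value 0 is never reached when [S] generates [G]. *)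
Definition word_dist (G : groupType) (S : seq G) (x y : G) : nat :=
  if pselect (exists n, joined_in S x y n) is left h then ex_minn h else 0.

Definition gromov_product (G : groupType) (S : seq G) (x y w : G) : rat :=
  (((word_dist S x w)%:R + (word_dist S y w)%:R - (word_dist S x y)%:R)
     / 2%:R)%R.

(* Gromov's inequality for the word metric; [delta] ranges over the rationals,
   which loses nothing as it is existentially quantified in [hyperbolic]. *)
Definition gromov_hyperbolic_wrt (G : groupType) (S : seq G) (delta : rat) :
    Prop :=
  forall x y z w : G,
    (Num.min (gromov_product S x y w) (gromov_product S y z w) - delta
       <= gromov_product S x z w)%R.

Definition hyperbolic (G : groupType) : Prop :=
  exists S : seq G, generates S /\
    exists delta : rat, gromov_hyperbolic_wrt S delta.

(* [x :: p] is the vertex sequence of a geodesic from [x] to [last x p]. *)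
Definition geodesic (G : groupType) (S : seq G) (x : G) (p : seq G) : Prop :=
  path (cayley_edge S) x p /\ size p = word_dist S x (last x p).

(* Every point of an edge geodesic is within 1/2 of one of its vertices, so
   only the vertices are required to be close to [Y]. *)
Definition quasiconvex_wrt (G : groupType) (S : seq G) (Y : set G) : Prop :=
  exists eps : nat, forall (x : G) (p : seq G),
    Y x -> Y (last x p) -> geodesic S x p ->
    forall v, v \in x :: p -> exists2 y, Y y & (word_dist S v y <= eps)%N.

(* The generating set is not tied to one witnessing hyperbolicity of [G]. *)
Definition quasiconvex (G : groupType) (Y : set G) : Prop :=
  exists S : seq G, generates S /\ quasiconvex_wrt S Y.

(* The left cosets [h A], for [h] in [H], form a finite set. *)
Definition finite_index (G : groupType) (A H : set G) : Prop :=
  A `<=` H /\ finite_set [set [set h * a | a in A] | h in H].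

(* Main.v *)
Require Import Defs.
From mathcomp Require Import all_boot all_order all_algebra.
From mathcomp Require Import boolp classical_sets cardinality.
From mathcomp Require Import zify lra.

(* By B. H. Neumann's lemma it is enough to cover [H2] by finitely many cosets
   of conjugates of [H1].

   Suppose first that for some finite part of [H2] every [h] in [H2] has a
   multiple [u = h c], with [c] in that part, such that the Gromov product of
   [u] and [u^-1] at [1] is bounded. If [u] is long, its powers form a uniform
   quasigeodesic. If moreover [g^-1 u g] is in [H1], then [1] is uniformly close
   to the geodesics from [u^-n g] to [u^n g] for large [n], and these stay near
   [g H1]: hence [u] is conjugate into [H1] by a uniformly short element, which
   puts [h] in one of finitely many cosets of conjugates.

   Otherwise every finite part [F] of [H2] moves some [x] very little compared
   with [|x|], as if it fixed a point at infinity. On a geodesic from [1] to [x]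
   every [c] in [F] then acts, up to a uniform error, as the shift by
   [|c x| - |x|], and this number is a quasimorphism. As balls are finite, either
   these shifts are bounded and [H2] is finite, or some [c] in [H2] with a
   definite shift generates a subgroup of finite index. *)

Set Implicit Arguments.
Unset Strict Implicit.
Unset Printing Implicit Defensive.

Import Order.TTheory GRing.Theory Num.Theory.

Local Open Scope classical_set_scope.
Local Open Scope group_scope.

(** * The word metric of a finite generating set *)

Section WordMetric.
Variables (G : groupType) (S : seq G).
Hypothesis genS : generates S.
Local Notation d := (word_dist S).

Definition joined (x y : G) (n : nat) : Prop :=
  exists p : seq G, [/\ path (cayley_edge S) x p, last x p = y & size p = n].

Lemma cayley_edge_sym : symmetric (cayley_edge S).
Proof. by move=> x y; rewrite /cayley_edge orbC. Qed.

Lemma cayley_edgeM g x y : cayley_edge S (g * x) (g * y) = cayley_edge S x y.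
Proof. by rewrite /cayley_edge !invgM !mulgA !mulgVK. Qed.

Lemma joinedM g x y n : joined x y n -> joined (g * x) (g * y) n.
Proof.
move=> [p [pp <- <-]]; exists (map (fun z => g * z) p); split.
- by rewrite path_map (eq_path (e' := cayley_edge S)) // => a b; exact: cayley_edgeM.
- by rewrite last_map.
- by rewrite size_map.
Qed.

Lemma joined_cat x y z m n : joined x y m -> joined y z n -> joined x z (m + n).
Proof.
move=> [p [pp <- <-]] [q [qq <- <-]]; exists (p ++ q).
by rewrite cat_path pp qq last_cat size_cat.
Qed.

Lemma joined_sym x y n : joined x y n -> joined y x n.
Proof.
move=> [p [pp <- <-]]; exists (rev (belast x p)); split.
- by rewrite rev_path (eq_path (e' := cayley_edge S)) // => a b; exact: cayley_edge_sym.
- by case: p pp => //= a p _; rewrite rev_cons last_rcons.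
- by rewrite size_rev size_belast.
Qed.

Lemma joined_generates x y : exists n, joined x y n.
Proof.
pose K : set G := [set z | exists n, joined 1 z n].
have KT : K = setT.
  apply: genS => [|s sS].
    split=> [|a b]; rewrite !inE.
      by exists 0%N, [::].
    move=> [m am] [n bn]; exists (m + n)%N; apply: joined_cat am _.
    by have := joinedM (a / b) (joined_sym bn); rewrite mulgVK mulg1.
  by exists 1%N, [:: s]; rewrite /= /cayley_edge invg1 mul1g (sS : s \in S).
have [n nP] : K (x^-1 * y) by rewrite KT.
by exists n; have := joinedM x nP; rewrite mulg1 mulVKg.
Qed.

Lemma joined_word_dist x y : joined x y (d x y).
Proof.
rewrite /word_dist; case: pselect => [h|]; first by case: ex_minnP => m /asboolP.
by have [n nP] := joined_generates x y; case; exists n; apply/asboolP.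
Qed.

Lemma word_dist_le x y n : joined x y n -> d x y <= n.
Proof.
move=> nP; rewrite /word_dist; case: pselect => // h.
by case: ex_minnP => m _; apply; apply/asboolP.
Qed.

Lemma word_distxx x : d x x = 0%N.
Proof. by apply/eqP; rewrite -leqn0; apply: word_dist_le; exists [::]. Qed.

Lemma word_dist_eq0 x y : d x y = 0%N -> x = y.
Proof.
have [p [_ + sp]] := joined_word_dist x y => + d0.
by move: sp; rewrite d0 => /size0nil ->.
Qed.

Lemma word_dist_sym x y : d x y = d y x.
Proof.
by apply/eqP; rewrite eqn_leq; apply/andP; split; apply: word_dist_le;
  apply: joined_sym; exact: joined_word_dist.
Qed.

Lemma word_dist_triangle x y z : d x z <= d x y + d y z.
Proof. by apply/word_dist_le/joined_cat/joined_word_dist/joined_word_dist. Qed.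

Lemma word_distM g x y : d (g * x) (g * y) = d x y.
Proof.
apply/eqP; rewrite eqn_leq; apply/andP; split; apply: word_dist_le.
  exact/joinedM/joined_word_dist.
by have := joinedM g^-1 (joined_word_dist (g * x) (g * y)); rewrite !mulKg.
Qed.

Lemma word_dist_ball n : exists B : seq G, forall x, d 1 x <= n -> x \in B.
Proof.
elim: n => [|n [B BP]].
  by exists [:: 1] => x; rewrite leqn0 => /eqP /word_dist_eq0 <-; rewrite inE.
exists (B ++ [seq b * s | b <- B, s <- S ++ map (fun s => s^-1) S]) => x.
rewrite leq_eqVlt => /orP [/eqP dx|]; last by rewrite ltnS mem_cat => /BP ->.
have [p [pp lp]] := joined_word_dist 1 x; rewrite dx.
case/lastP: p pp lp => // p y; rewrite rcons_path last_rcons size_rcons.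
move=> /andP [pp e] <- [sp]; rewrite mem_cat; apply/orP; right.
apply/allpairsP; exists (last 1 p, (last 1 p)^-1 * y); split=> /=.
- by apply/BP/word_dist_le; exists p.
- rewrite mem_cat; case/orP: e => [->//|e]; apply/orP; right.
  by apply/mapP; exists (y^-1 * last 1 p); rewrite // invgM invgK.
- by rewrite mulVKg.
Qed.

Lemma geodesic_param x y : exists p : seq G,
  [/\ geodesic S x p, last x p = y &
    forall i j, i <= size p -> j <= size p ->
      d (nth x (x :: p) i) (nth x (x :: p) j) = (i - j + (j - i))%N].
Proof.
have [p [pp lp sp]] := joined_word_dist x y; exists p; split=> //.
  by split; rewrite // sp lp.
pose q i := nth x (x :: p) i.
have sub i j : i <= j -> j <= size p -> d (q i) (q j) <= j - i.
  move=> ij jp; apply: word_dist_le.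
  exists (take (j - i) (drop i p)); split.
  - have := pp; rewrite -{1}(cat_take_drop i p) cat_path => /andP [_].
    have -> : last x (take i p) = q i.
      rewrite /q (last_nth x) size_take_min (minn_idPl _) ?(leq_trans ij) //.
      by case: i ij => //= i ij; rewrite nth_take.
    by rewrite -{1}(cat_take_drop (j - i) (drop i p)) cat_path => /andP [].
  - rewrite (last_nth x) size_take_min size_drop.
    have -> : minn (j - i) (size p - i) = (j - i)%N by lia.
    case e : (j - i)%N => [|k] /=; first by congr q; lia.
    rewrite nth_take // nth_drop /q (_ : j = (i + k).+1) //=; lia.
  - by rewrite size_take_min size_drop; lia.
have eqd i j : i <= j -> j <= size p -> d (q i) (q j) = (j - i)%N.
  move=> ij jp; have h1 := sub 0%N i isT (leq_trans ij jp).
  have h2 := sub i j ij jp; have h3 := sub j (size p) jp (leqnn _).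
  have q0 : q 0%N = x by [].
  have qn : q (size p) = y by rewrite -lp (last_nth x).
  move: h1 h3; rewrite q0 qn => h1 h3.
  have := word_dist_triangle x (q i) y.
  have := word_dist_triangle (q i) (q j) y; lia.
move=> i j ip jp; rewrite -/(q i) -/(q j).
case: (leqP i j) => h; first by rewrite eqd //; lia.
rewrite word_dist_sym eqd //; lia.
Qed.

Lemma word_dist_between x y n : n <= d x y ->
  exists2 z, d x z = n & d z y = (d x y - n)%N.
Proof.
move=> nd; have [p [[_ sp] lp pd]] := geodesic_param x y; rewrite lp in sp.
exists (nth x (x :: p) n).
  by rewrite -[in d x _](_ : nth x (x :: p) 0 = x) // pd //; lia.
rewrite -[y in d _ y]lp (last_nth x) pd //; lia.
Qed.

End WordMetric.

(** A number bounded linearly in the logarithm of a multiple of itself is bounded; [m] stands for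
    the logarithm. *)
Lemma sublinear_bound (a b c : nat) : 0 < c -> exists M, forall n : nat,
  (forall m : nat, (c * n <= 2 ^ m)%N -> (n <= a + b * m)%N) -> (n <= M)%N.
Proof.
(* For large [q], [m = q] is admissible; as [K > 2 * b * c], the term [b * q] is then at most
   [n / 2], so [n <= 2 * a]. *)
move=> c0; pose K := (2 * b * c).+1.
exists ((2 * K + 2) * K + 2 * a)%N => n hn.
have nc : (n <= c * n)%N by rewrite leq_pmull.
pose q := (c * n %/ K)%N.
have [qK|qK] := ltnP q (2 * K + 2).
  by rewrite ltn_divLR // in qK; lia.
have e2 : (K * q.+1 <= 2 ^ q)%N.
  rewrite -(subnK qK); elim: (q - _)%N => [|r IHr].
    have := ltn_expl K (isT : 1 < 2)%N.
    rewrite add0n expnD mulnC expnM => h; rewrite expnAC; nia.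
  by rewrite addSn expnS; nia.
have cq : (c * n <= 2 ^ q)%N.
  by apply: leq_trans e2; rewrite (mulnC K); exact/ltnW/ltn_ceil.
have := hn _ cq; have := leq_trunc_div (c * n) K; rewrite -/q => h1 h2.
have : (c * (2 * b * q) <= c * n)%N by apply: leq_trans h1; rewrite /K; nia.
by rewrite leq_pmul2l // => h3; lia.
Qed.

(** * Four-point hyperbolicity and stability of quasigeodesics *)

Section Hyperbolic.
Variables (G : groupType) (S : seq G).
Hypothesis genS : generates S.
Local Notation d := (word_dist S).

(** Needed because quasiconvexity and hyperbolicity may come with different generating sets. *)
Lemma word_dist_lipschitz (S' : seq G) : generates S' ->
  exists l, forall x y, (d x y <= l * word_dist S' x y)%N.
Proof.
move=> genS'; exists (\sum_(s <- S') d 1 s)%N => x y.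
have [p [+ <- <-]] := joined_word_dist genS' x y.
elim: p x => [|z p IHp] x /=; first by rewrite word_distxx.
move=> /andP [xz pp]; have := IHp z pp.
have := word_dist_triangle genS x z (last z p).
suff : (d x z <= \sum_(s <- S') d 1 s)%N by rewrite mulnS; lia.
have le s : s \in S' -> (d 1 s <= \sum_(s <- S') d 1 s)%N.
  by move=> sS; rewrite (big_rem _ sS) /= leq_addr.
case/orP: xz => /le; first by rewrite -(word_distM genS x) mulg1 mulVKg.
by rewrite -(word_distM genS z) mulg1 mulVKg word_dist_sym.
Qed.

(* Gromov's inequality multiplied by 2 and written without subtractions. *)
Definition four_point (D : nat) := forall x y z w : G,
  (d x z + d y w <= maxn (d x y + d z w) (d y z + d x w) + D)%N.

Lemma hyperbolic_four_point (delta : rat) :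
  gromov_hyperbolic_wrt S delta -> exists D, four_point D.
Proof.
move=> hyp; have [D hD] : exists D : nat, (2%:R * delta <= D%:R)%R.
  exists (Num.bound `|2%:R * delta|%R).
  apply: le_trans (ler_norm _) (ltW _); apply: archi_boundP; exact: normr_ge0.
exists D => x y z w; have := hyp x y z w; rewrite /gromov_product.
rewrite leqNgt; apply: contraTN => h.
have {}h : (d x y + d z w + D < d x z + d y w /\
            d y z + d x w + D < d x z + d y w)%N by lia.
move: h; rewrite -!(ltr_nat rat) !natrD => -[h1 h2].
by rewrite -ltNge minEle; case: ifP => _; lra.
Qed.

(** Bisection of a path of at most [2 ^ m] steps: each of the [m] levels costs [D]. The conclusion
    bounds the Gromov product of the ends at [x] below by [r - (l + m * D) / 2]. *)
Lemma four_point_chain (D : nat) (f : nat -> G) (x : G) (r l : nat) :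
  four_point D -> forall m i j, (i <= j <= i + 2 ^ m)%N ->
  (forall t, i <= t < j -> d (f t) (f t.+1) <= l)%N ->
  (forall t, i <= t <= j -> r <= d x (f t))%N ->
  (d (f i) (f j) + 2 * r <= d x (f i) + d x (f j) + l + m * D)%N.
Proof.
move=> fp; elim=> [|m IHm] i j ij fl fr.
  have := fl i; have := fr i; have := fr j; have : j = i \/ j = i.+1 by lia.
  by case=> ->; rewrite ?word_distxx; lia.
have h1 := IHm i (minn j (i + 2 ^ m)).
have h2 := IHm (minn j (i + 2 ^ m)) j.
rewrite expnS in ij; move: h1 h2; move eqk: (minn _ _) => k h1 h2.
have := fp (f i) (f k) (f j) x.
have {}h1 : (d (f i) (f k) + 2 * r <= d x (f i) + d x (f k) + l + m * D)%N.
  by apply: h1 => [|t ht|t ht]; [|apply: fl|apply: fr]; lia.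
have {}h2 : (d (f k) (f j) + 2 * r <= d x (f k) + d x (f j) + l + m * D)%N.
  by apply: h2 => [|t ht|t ht]; [|apply: fl|apply: fr]; lia.
rewrite !(word_dist_sym genS _ x) mulSn; lia.
Qed.

(* [M] is the largest distance to the quasigeodesic from a point [x0] that almost
   lies between its ends. Points [y], [z] at distance [2 * M] on both sides of
   [x0] are within [M] of points [f i], [f j]. The stretch from [f i] to [f j] has
   length linear in [M] and avoids the [M]-ball around [x0], so by
   [four_point_chain] [M] is bounded by a logarithm of [M]. *)
Lemma quasigeodesic_near (D l k : nat) : four_point D ->
  exists E, forall (f : nat -> G) N,
    (forall i, i < N -> d (f i) (f i.+1) <= l)%N ->
    (forall i j, i <= j -> j <= N -> j - i <= l * d (f i) (f j))%N ->
    forall x, (d (f 0) x + d x (f N) <= d (f 0) (f N) + k)%N ->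
    exists2 i, (i <= N)%N & (d x (f i) <= E)%N.
Proof.
have tri := word_dist_triangle genS; have sym := word_dist_sym genS.
(* [6 * l] arises from [d (f i) (f j) <= 6 * M] below; the successor makes the factor positive. *)
move=> fp; have [E hE] := @sublinear_bound (k + l + 2 * D) D (6 * l).+1 isT.
exists E => f N fl qg x hx.
pose exc z := (d (f 0) z + d z (f N) <= d (f 0) (f N) + k)%N.
pose P n := `[< exists2 z, exc z & forall i, (i <= N)%N -> (n <= d z (f i))%N >].
have P0 : exists n, P n by exists 0%N; apply/asboolP; exists x.
have PB n : P n -> (n <= d (f 0) (f N) + k)%N.
  move=> /asboolP [z hz /(_ 0%N isT)]; rewrite /exc in hz.
  by rewrite (sym z (f 0%N)); lia.
case: (ex_maxnP P0 PB) => M /asboolP [x0 ex0 far] maxM.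
have near z : exc z -> exists2 i, (i <= N)%N & (d z (f i) <= M)%N.
  move=> ez; apply: contrapT => no; suff /maxM : P M.+1 by rewrite ltnn.
  apply/asboolP; exists z => // i iN; rewrite ltnNge; apply/negP => h.
  by apply: no; exists i.
suff ME : (M <= E)%N by have [i iN hi] := near x hx; exists i; rewrite // (leq_trans hi).
(* If the end [f e] is already within [2 * M] of [x0], it serves as [y] itself. *)
have side e : (e <= N)%N -> (forall z, (d (f e) z + d z x0 = d (f e) x0)%N -> exc z) ->
  exists y i, [/\ (i <= N)%N, (d (f e) y + d y x0 = d (f e) x0)%N,
    (2 * M + d y (f i) <= d y x0 + d x0 (f i))%N & (d x0 (f i) <= 3 * M)%N].
  move=> eN ye; have [le|lt] := leqP (d (f e) x0) (2 * M).
    exists (f e), e; rewrite !word_distxx (word_dist_sym genS (f e)) in le *.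
    by split; rewrite ?add0n //; have := far e eN; lia.
  have sz : (2 * M <= d x0 (f e))%N by rewrite sym; lia.
  have [y y1 y2] := word_dist_between genS sz.
  have yx : (d (f e) y + d y x0 = d (f e) x0)%N.
    by rewrite !(sym (f e)) (sym y x0); lia.
  have [i iN hi] := near y (ye y yx).
  exists y, i; split=> //; rewrite ?(sym y x0); have := far i iN;
    have := tri x0 y (f i); lia.
have [|y [i [iN y1 y2 y3]]] := side 0%N isT.
  by move=> z hz; rewrite /exc in ex0 *; have := tri z x0 (f N); lia.
have [|z [j [jN z1 z2 z3]]] := side N (leqnn N).
  move=> z hz; rewrite /exc in ex0 *; have := tri (f 0) x0 z.
  by have := sym z (f N); have := sym z x0; have := sym x0 (f N); lia.
apply: hE => m hm.
have cij : (d (f i) (f j) + 2 * M <= d x0 (f i) + d x0 (f j) + l + m * D)%N.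
  have dij : (d (f i) (f j) <= 6 * M)%N.
    by have := tri (f i) x0 (f j); have := sym (f i) x0; lia.
  have [ij|ji] := leqP i j.
    apply: four_point_chain => // [|t ht|t ht]; [|apply: fl|apply: far]; try lia.
    by have := qg i j ij jN; nia.
  rewrite sym (addnC (d x0 (f i))).
  apply: four_point_chain => // [|t ht|t ht]; [|apply: fl|apply: far]; try lia.
  by have := qg j i (ltnW ji) iN; rewrite (sym (f j)); nia.
(* At [x0] the Gromov products of [y] with [f i] and of [z] with [f j] are at least [M], and that of
   [y] with [z] is at most [k / 2]. Two four-point inequalities link these with [cij]. *)
have := fp y (f i) z x0; have := fp (f i) (f j) z x0.
have := tri (f 0) y (f N); have := tri y z (f N).
have := sym y x0; have := sym z x0; have := sym (f i) x0; have := sym (f j) x0.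
have := sym (f N) z; have := sym (f N) x0; have := sym (f j) z; rewrite /exc in ex0; lia.
Qed.

End Hyperbolic.

(** A geodesic for [T] is a quasigeodesic for [S], so it passes near every [x] almost between its
    ends, and quasiconvexity keeps it near [Y]. *)
Lemma quasiconvex_near (G : groupType) (S : seq G) (D : nat) (Y : set G) :
  generates S -> four_point S D -> quasiconvex Y ->
  forall k, exists E, forall a b x, Y a -> Y b ->
    (word_dist S a x + word_dist S x b <= word_dist S a b + k)%N ->
    exists2 y, Y y & (word_dist S x y <= E)%N.
Proof.
move=> genS fp [T [genT [eps qc]]] k.
have [l1 hl1] := word_dist_lipschitz genS genT.
have [l2 hl2] := word_dist_lipschitz genT genS.
have [E hE] := quasigeodesic_near genS (l1 + l2) k fp.
exists (E + l1 * eps)%N => a b x Ya Yb hx.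
have [p [geo lp pd]] := geodesic_param genT a b.
pose f i := nth a (a :: p) i.
have fN : f (size p) = b by rewrite -lp (last_nth a).
have [i iN|i j ij jN||i iN hi] := hE f (size p) _ _ x.
- by apply: (leq_trans (hl1 _ _)); rewrite pd //; nia.
- apply: leq_trans (_ : word_dist T (f i) (f j) <= _)%N; first by rewrite pd //; lia.
  by apply: (leq_trans (hl2 _ _)); nia.
- by rewrite fN.
have Yl : Y (last a p) by rewrite lp.
have [|y Yy hy] := qc a p Ya Yl geo (f i); first exact: mem_nth.
exists y => //; apply: leq_trans (word_dist_triangle genS x (f i) y) _.
by apply: leq_add => //; apply: (leq_trans (hl1 _ _)); rewrite leq_mul.
Qed.

(** * Coset covers and finite index *)

Section Subgroups.
Variable G : groupType.
Implicit Types (H K A : set G) (x y : G).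

Lemma subgroup1 H : subgroup H -> H 1.
Proof. by move=> [+ _]; rewrite inE. Qed.

Lemma subgroupD H x y : subgroup H -> H x -> H y -> H (x / y).
Proof. by move=> [_ sH] Hx Hy; have := sH x y; rewrite !inE; exact. Qed.

Lemma subgroupV H x : subgroup H -> H x -> H x^-1.
Proof.
by move=> sH Hx; rewrite -[x^-1]mul1g; apply: subgroupD => //; exact: subgroup1.
Qed.

Lemma subgroupM H x y : subgroup H -> H x -> H y -> H (x * y).
Proof.
by move=> sH Hx Hy; rewrite -[y]invgK; apply: subgroupD => //; exact: subgroupV.
Qed.

Lemma subgroup_intro H : H 1 -> (forall x y, H x -> H y -> H (x / y)) -> subgroup H.
Proof. by move=> H1 HD; split=> [|x y]; rewrite !inE //; exact: HD. Qed.

Lemma subgroupI H K : subgroup H -> subgroup K -> subgroup (H `&` K).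
Proof.
move=> sH sK; apply: subgroup_intro; first by split; exact: subgroup1.
by move=> x y [Hx Kx] [Hy Ky]; split; exact: subgroupD.
Qed.

Lemma subgroup_conj H b : subgroup H -> subgroup [set k | H (b * k * b^-1)].
Proof.
move=> sH; apply: subgroup_intro => [|x y Hx Hy] /=.
  by rewrite mulg1 mulgV; exact: subgroup1.
have := subgroupD sH Hx Hy; congr H.
by rewrite !invgM invgK !mulgA mulgVK.
Qed.

Lemma finite_index_cover H K (C : seq G) : subgroup H -> subgroup K ->
  (forall h, H h -> exists2 c, c \in C & K (c^-1 * h)) ->
  finite_index (H `&` K) H.
Proof.
move=> sH sK cov; split; first by move=> x [].
pose F c : set G := [set x | H x /\ K (c^-1 * x)].
apply: (@sub_finite_set _ _ (F @` [set` C])); last exact/finite_image/finite_seq.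
move=> _ [h Hh <-]; have [c cC Kc] := cov h Hh; exists c => //.
apply/seteqP; split=> x /=.
  move=> [Hx Kx]; exists (h^-1 * x); last by rewrite mulVKg.
  split; first exact: subgroupM (subgroupV sH Hh) Hx.
  have := subgroupM sK (subgroupV sK Kc) Kx.
  by rewrite invgM invgK !mulgA mulgK.
move=> [a [Ha Ka] <-]; split; first exact: subgroupM.
by rewrite mulgA; exact: subgroupM.
Qed.

(* If some coset [h0 K b] is missing from the cover, it is covered by cosets of
   the other subgroups, and so is every other coset of [K b]. *)
Lemma neumann_cover H (K : G -> set G) (bs : seq G) (L : seq (G * G)) :
  subgroup H -> (forall b, subgroup (K b)) ->
  (forall h, H h -> exists2 gb, gb \in L & gb.2 \in bs /\ K gb.2 (gb.1^-1 * h)) ->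
  exists b (C : seq G), forall h, H h -> exists2 c, c \in C & K b (c^-1 * h).
Proof.
move=> sH sK; elim: bs L => [|b bs IHbs] L cov.
  by have [? _ []] := cov 1 (subgroup1 sH).
have [all_b|] := pselect (forall h, H h ->
    exists2 gb, gb \in L & gb.2 = b /\ K b (gb.1^-1 * h)).
  exists b, (map fst L) => h /all_b [gb gbL [_ Kh]].
  by exists gb.1; rewrite // map_f.
move=> /existsNP [h0 /not_implyP [Hh0 no]].
(* [h0 * (w g)^-1] carries the coset [g * K b] to that of [h0]. The default [1] is harmless: [w g]
   is used only when some [h] in [H] lies in [g * K b]. *)
pose w g := xget 1 [set h | H h /\ K b (g^-1 * h)].
apply: (IHbs (L ++ [seq (w gb.1 * h0^-1 * gb'.1, gb'.2) | gb <- L, gb' <- L])) => h Hh.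
have [[g b1] gL /= [+ Kh]] := cov h Hh; rewrite inE => /orP [/eqP b1b|bbs]; last first.
  by exists (g, b1); rewrite // mem_cat gL.
rewrite {}b1b in gL Kh.
have [Hw Kw] : H (w g) /\ K b (g^-1 * w g).
  by rewrite /w; case: xgetP => [y _ //|/(_ h)]; case.
have Hh1 : H (h0 * (w g)^-1 * h).
  by apply: subgroupM => //; exact: subgroupD.
have [[g' b'] g'L /= [+ Kh']] := cov _ Hh1.
rewrite inE => /orP [/eqP b'b|b'bs]; last first.
  exists (w g * h0^-1 * g', b'); last by split; rewrite // !invgM !invgK -!mulgA in Kh' *.
  rewrite mem_cat; apply/orP; right.
  by apply/allpairsP; exists ((g, b), (g', b')).
case: no; exists (g', b'); rewrite // b'b in Kh' *; split=> //=.
have := subgroupD (sK b) Kh' (subgroupM (sK b) (subgroupV (sK b) Kw) Kh).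
by rewrite !invgM !invgK !mulgA !(mulgK, mulgVK).
Qed.

(** Elements of [H] in distinct left cosets of [A] yield distinct elements of [B], so there are at
    most [size B] of them, and a maximal such family represents all cosets. *)
Lemma bounded_index_cover H A (B : seq G) : subgroup H -> subgroup A ->
  (forall F : seq G, (forall f : G, f \in F -> H f) ->
    exists p, forall f : G, f \in F -> exists2 e, A e & p^-1 * (f * e) * p \in B) ->
  exists C : seq G, forall h, H h -> exists2 c, c \in C & A (c^-1 * h).
Proof.
move=> sH sA hF.
pose sep : rel G := fun x y => ~~ `[< A (x^-1 * y) >].
pose P n := `[< exists F : seq G,
  [/\ forall f : G, f \in F -> H f, pairwise sep F & size F = n] >].
have P0 : exists n, P n by exists 0%N; apply/asboolP; exists [::].
have PB n : P n -> (n <= size B)%N.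
  move=> /asboolP [F [FH sepF <-]]; have [p hp] := hF F FH.
  have /choice [e he] : forall f : G, exists e,
      f \in F -> A e /\ p^-1 * (f * e) * p \in B.
    move=> f; have [fF|] := boolP (f \in F); last by exists 1.
    by have [e Ae Be] := hp f fF; exists e.
  rewrite -(size_map (fun f => p^-1 * (f * e f) * p) F); apply: uniq_leq_size.
    rewrite uniq_pairwise pairwise_map.
    apply: (sub_in_pairwise _ (allss F)) sepF => x y xF yF /=.
    apply: contra => /eqP /mulIg /mulgI xy; apply/asboolP.
    have -> : x^-1 * y = e x / e y.
      by apply: (mulgI x); apply: (mulIg (e y)); rewrite mulVKg mulgA mulgVK.
    by apply: subgroupD => //; [case: (he x xF)|case: (he y yF)].
  by move=> _ /mapP [f fF ->]; case: (he f fF).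
case: (ex_maxnP P0 PB) => n /asboolP [F [FH sepF sF]] maxF.
exists F => h Hh; apply: contrapT => no.
suff /maxF : P n.+1 by rewrite ltnn.
apply/asboolP; exists (h :: F); rewrite /= sF; split=> //.
  by move=> f; rewrite inE => /orP [/eqP ->//|/FH].
rewrite sepF andbT; apply/allP => c cF; apply/asboolP => Ac.
by apply: no; exists c => //; have := subgroupV sA Ac; rewrite invgM invgK.
Qed.

End Subgroups.

(** * Powers of long elements, and shifts along geodesics *)

Section HyperbolicTranslations.
Variables (G : groupType) (S : seq G) (D : nat).
Hypotheses (genS : generates S) (fp : four_point S D).
Local Notation d := (word_dist S).
Local Notation len := (word_dist S 1).

Let sym := word_dist_sym genS.
Let tri := word_dist_triangle genS.
Let inv := word_distM genS.

Lemma word_normV x : len (x^-1) = len x.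
Proof. by rewrite -(inv x) mulgV mulg1 sym. Qed.

Lemma word_normM x y : (len (x * y) <= len x + len y)%N.
Proof. by apply: leq_trans (tri 1 x _) _; rewrite -[X in d X (x * y)]mulg1 inv. Qed.

Section Powers.
Variables (R : nat) (u : G).
Hypotheses (uR : (2 * len u <= len (u * u) + R)%N) (u_long : (R + 2 * D < len u)%N).
Local Notation a n := (len (u ^+ n)).

Let dpow m n : d (u ^- m) (u ^+ n) = a (m + n).
Proof. by rewrite -(inv (u ^+ m)) mulgV -expgnDr. Qed.

Let dpowS n : d (u ^+ n.+1) u = a n.
Proof. by rewrite expgS -[X in d _ X]mulg1 inv sym. Qed.

Let dpowV n : d u^-1 (u ^- n.+1) = a n.
Proof. by rewrite expgSr invgM -[X in d X]mulg1 inv word_normV. Qed.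

(* The Gromov product of [u ^- n] and [u] at [1] is at most [(R + D) / 2]. *)
Lemma power_step n : (a n + len u <= a n.+1 + R + D)%N.
Proof.
elim: n => [|n IHn].
  by rewrite expg0 expg1 word_distxx; lia.
have := fp u^-1 (u ^- n.+1) u 1.
have -> : d u^-1 u = len (u * u) by rewrite -(inv u) mulgV.
rewrite dpowV [d (u ^- _) u](dpow n.+1 1) !(sym _ 1) !word_normV addn1; lia.
Qed.

Lemma power_norm_ge n : (n <= a n)%N.
Proof. by elim: n => // n IHn; have := power_step n; lia. Qed.

(** The Gromov product of [u ^- n] and [u ^+ n] at [1] is bounded independently of [n]. *)
Lemma power_double n : (2 * a n <= a (n + n) + R + 2 * D)%N.
Proof.
case: n => [|[|n]]; first by rewrite expg0 word_distxx; lia.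
  by have := power_step 1; rewrite addn1 !expg1; lia.
have := fp (u ^- n.+2) (u ^+ n.+2) u 1.
rewrite dpow dpowS [d (u ^- _) u](dpow n.+2 1) !(sym _ 1) word_normV addn1.
have := power_step n.+1; have := power_step n.+2; lia.
Qed.

(** For large [n], [g^-1] almost lies between the elements [g^-1 * u ^- n * g] and
    [g^-1 * u ^+ n * g] of [Y], hence is close to some [y] in [Y]; then [e = y^-1 * g^-1] is short.
    The slack [4 * D] is [2 * D] from [power_double] and [D] for each end moved by [g]. *)
Lemma short_conjugator (Y : set G) E : subgroup Y ->
  (forall a b x, Y a -> Y b -> (d a x + d x b <= d a b + (R + 4 * D))%N ->
     exists2 y, Y y & (d x y <= E)%N) ->
  forall g, Y (g^-1 * u * g) ->
  exists2 e, (len e <= E)%N & Y (e * u * e^-1).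
Proof.
move=> sY near g Yv; pose n := (2 * len g + R + 4 * D).+1.
have Yp m : Y (g^-1 * u ^+ m * g).
  elim: m => [|m IHm]; first by rewrite expg0 mulg1 mulVg; exact: subgroup1.
  by have := subgroupM sY IHm Yv; rewrite expgSr !mulgA mulgK.
have Yn m : Y (g^-1 * u ^- m * g).
  by have := subgroupV sY (Yp m); rewrite !invgM invgK mulgA.
have [|y Yy hy] := near _ _ g^-1 (Yn n) (Yp n).
  have e1 : d (g^-1 * u ^- n * g) g^-1 = len (u ^- n * g).
    by rewrite -mulgA -[X in d _ X]mulg1 inv sym.
  have e2 : d g^-1 (g^-1 * u ^+ n * g) = len (u ^+ n * g).
    by rewrite -mulgA -[X in d X]mulg1 inv.
  have e3 : d (g^-1 * u ^- n * g) (g^-1 * u ^+ n * g) = d (u ^- n * g) (u ^+ n * g).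
    by rewrite -!mulgA inv.
  have da x : d x (x * g) = len g by rewrite -[X in d X]mulg1 inv.
  have := power_double n; have := power_norm_ge n.
  have := fp (u ^- n) (u ^- n * g) (u ^+ n) 1.
  have := fp (u ^- n * g) (u ^+ n * g) (u ^+ n) 1.
  have := tri 1 (u ^- n * g) (u ^- n); have := tri 1 (u ^+ n * g) (u ^+ n).
  rewrite (sym (u ^- n * g) (u ^- n)) (sym (u ^+ n * g) (u ^+ n)) e1 e2 e3 !da.
  rewrite dpow !(sym _ 1) word_normV /n; lia.
exists (y^-1 * g^-1).
  by rewrite -(inv y) mulg1 mulVKg sym.
have := subgroupM sY (subgroupM sY (subgroupV sY Yy) Yv) Yy.
by rewrite invgM !invgK !mulgA.
Qed.

End Powers.

(* [len (c * x) - len x] plays the role of a Busemann cocycle at [x]; it is added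
   to [t] before subtracting so as not to be truncated. *)
Lemma shift_geodesic (R M t : nat) (c x : G) (p : nat -> G) :
  (forall i j, i <= len x -> j <= len x -> d (p i) (p j) = i - j + (j - i))%N ->
  p 0%N = 1 -> p (len x) = x ->
  (len c <= M)%N -> (R <= 2 * len x)%N ->
  (d x (c * x) + R <= len x + len (c * x))%N ->
  (M + D < t)%N -> (2 * t + 4 * M + 4 * D < R)%N ->
  (d (c * p t) (p (t + len (c * x) - len x)) <= 2 * D)%N.
Proof.
move=> hp p0 px cM xR cx tM tR.
have pn i : (i <= len x)%N -> len (p i) = i by move=> ix; rewrite -p0 hp //; lia.
have pd i : (i <= len x)%N -> d (p i) x = (len x - i)%N.
  by move=> ix; rewrite -[X in d _ X]px hp //; lia.
have tx : (t <= len x)%N by lia.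
have := word_normM c x; have := word_normM c^-1 (c * x).
rewrite mulKg word_normV => c1 c2.
move er: (t + len (c * x) - len x)%N => r.
have rx : (r <= len x)%N by lia.
have := pn t tx; have := pd t tx; have := pn r rx; have := pd r rx.
have d1 : d c (c * p t) = len (p t) by rewrite -[X in d X]mulg1 inv.
have d2 : d c (c * x) = len x by rewrite -[X in d X]mulg1 inv.
have d3 : d (c * p t) (c * x) = d (p t) x by rewrite inv.
(* The three four-point inequalities give in turn [d 1 (c * p t) <= r + D],
   [d (c * p t) x <= len x - r + D] and the claim; the bounds on [t] and [R] dispose of the other
   terms of the first two maxima. *)
have := fp 1 c (c * p t) (c * x); have := tri 1 (c * p t) (c * x).
have := tri 1 (c * p t) c; rewrite (sym (c * p t) c).
have := fp 1 (c * p t) (c * x) x; have := fp 1 (c * p t) x (p r).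
rewrite (sym (c * x) x) (sym x (p r)) d1 d2 d3; lia.
Qed.

End HyperbolicTranslations.

(** * Subgroups almost fixing a point at infinity *)

Section AlmostFixed.
Variables (G : groupType) (S : seq G) (D : nat) (H : set G).
Hypotheses (genS : generates S) (fp : four_point S D) (sgH : subgroup H).
Local Notation d := (word_dist S).
Local Notation len := (word_dist S 1).

Let sym := word_dist_sym genS.
Let tri := word_dist_triangle genS.
Let inv := word_distM genS.

(* The Gromov product of [x] and [c * x] at [1] is large compared with [len c];
   the factor 20 leaves room for the uses of [shift_geodesic]. *)
Definition almost_fixed (M : nat) (x : G) := forall c : G, H c -> (len c <= M)%N ->
  (d x (c * x) + 20 * (M + D).+1 <= len x + len (c * x))%N.

Lemma almost_fixed_le M M' x : (M' <= M)%N -> almost_fixed M x -> almost_fixed M' x.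
Proof. by move=> MM hx c Hc cM; have := hx c Hc (leq_trans cM MM); lia. Qed.

Lemma almost_fixed_shift M x : almost_fixed M x -> exists p : nat -> G,
  (forall i j, i <= len x -> j <= len x -> d (p i) (p j) = i - j + (j - i))%N /\
  forall c t, H c -> (len c <= M)%N -> (M + D < t)%N -> (t < 6 * (M + D).+1)%N ->
    (d (c * p t) (p (t + len (c * x) - len x)) <= 2 * D)%N /\
    (t + len (c * x) - len x <= len x)%N.
Proof.
move=> hx; have [p [[_ sp] lp hp]] := geodesic_param genS 1 x; rewrite lp in sp.
exists (nth 1 (1 :: p)); split; first by rewrite -sp.
(* Applied to the identity, [almost_fixed] says that [x] is long. *)
have xR : (20 * (M + D).+1 <= 2 * len x)%N.
  have := hx 1 (subgroup1 sgH); rewrite mul1g !word_distxx; lia.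
move=> c t Hc cM tM tR; split.
  apply: (@shift_geodesic G S D genS fp (20 * (M + D).+1) M); rewrite -?sp //; try lia.
    by rewrite -lp (last_nth 1).
  by rewrite sp; exact: hx.
by have := word_normM genS c x; lia.
Qed.

(** Shifting [p t] by [c] and then by [f], or at once by [f * c], ends at two points of the geodesic
    at most [6 * D] apart: three shifts, each with error [2 * D]. *)
Lemma shift_quasimorphism M x f c : almost_fixed M x -> H f -> H c ->
  (len f <= M)%N -> (len c <= M)%N -> (len (f * c) <= M)%N ->
  (len (f * x) + len (c * x) <= len (f * c * x) + len x + 6 * D)%N /\
  (len (f * c * x) + len x <= len (f * x) + len (c * x) + 6 * D)%N.
Proof.
move=> hx Hf Hc fM cM fcM; have [p [hp shift]] := almost_fixed_shift hx.
have bd g : (len g <= M -> len (g * x) <= M + len x /\ len x <= M + len (g * x))%N.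
  have := word_normM genS g x; have := word_normM genS g^-1 (g * x).
  by rewrite mulKg word_normV //; lia.
have := bd f fM; have := bd c cM; have := bd _ fcM.
(* [t'] differs from [t] by at most [M], so this start keeps [t'] above [M + D], where the second
   shift applies. *)
move et: (2 * M + D).+1 => t; move et': (t + len (c * x) - len x)%N => t' b1 b2 b3.
have [||s1 _] := shift c t Hc cM; [lia..|].
have [||s2 s2'] := shift f t' Hf fM; [lia..|].
have [||s3 s3'] := shift (f * c) t (subgroupM sgH Hf Hc) fcM; [lia..|].
have {}s1 : (d (f * c * p t) (f * p t') <= 2 * D)%N by rewrite -mulgA inv -et'.
have := hp _ _ s2' s3'; move: s2 s3 s2' s3'.
move eqi: (t' + _ - _)%N => i; move eqj: (t + _ - _)%N => j s2 s3 _ _.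
have := tri (p i) (f * p t') (p j); have := tri (f * p t') (f * c * p t) (p j).
rewrite (sym (f * p t') (f * c * p t)) (sym (p i) (f * p t')); lia.
Qed.

(** The threshold is the quasimorphism error, so that multiplying by [c] changes a shift in a known
    direction. *)
Definition shifted (c x : G) :=
  (len (c * x) + 6 * D < len x)%N \/ (len x + 6 * D < len (c * x))%N.

(* By the quasimorphism property, multiplying by one of [c] and [c^-1] brings
   the shift of [f] strictly closer to zero, by at most [len c + 6 * D]. *)
Lemma shift_reduction M x c (A : set G) : almost_fixed M x -> H c ->
  subgroup A -> A c ->
  shifted c x ->
  forall k f, H f -> (len f + k.+1 * len c <= M)%N ->
  (len (f * x) <= len x + k + len c + 6 * D)%N ->
  (len x <= len (f * x) + k + len c + 6 * D)%N ->
  exists2 e, A e & [/\ H (f * e), (len (f * e) <= M)%N,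
    (len (f * e * x) <= len x + len c + 6 * D)%N &
    (len x <= len (f * e * x) + len c + 6 * D)%N].
Proof.
(* [k] bounds the excess of the shift over [len c + 6 * D]; each step lowers it and spends one
   [len c] of the reserve in [M]. *)
move=> hx Hc sA Ac big; elim=> [|k IHk] f Hf fM f1 f2.
  by exists 1; [exact: subgroup1|rewrite mulg1; split=> //; lia].
have Hv := subgroupV sgH Hc; have Av := subgroupV sA Ac.
rewrite 2!mulSn in fM; have cM : (len c <= M)%N by lia.
have m1 := word_normM genS f c; have m2 := word_normM genS f c^-1.
rewrite word_normV // in m2.
have := word_normM genS c x; have := word_normM genS c^-1 (c * x).
rewrite mulKg word_normV // => c1 c2.
have [|||q1 q2] := shift_quasimorphism hx Hf Hc; [lia..|].
have [|||q3 q4] := shift_quasimorphism hx (subgroupM sgH Hf Hv) Hc.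
1-3: by rewrite ?mulgVK; lia.
rewrite mulgVK in q3 q4.
have finish g : H g -> A g -> (len (f * g) <= len f + len c)%N ->
    (len (f * g * x) <= len x + k + len c + 6 * D)%N ->
    (len x <= len (f * g * x) + k + len c + 6 * D)%N ->
    exists2 e, A e & [/\ H (f * e), (len (f * e) <= M)%N,
      (len (f * e * x) <= len x + len c + 6 * D)%N &
      (len x <= len (f * e * x) + len c + 6 * D)%N].
  move=> Hg Ag fg g1 g2; have [||//|//|e Ae he] := IHk (f * g).
  - exact: subgroupM.
  - by rewrite mulSn; lia.
  by exists (g * e); [exact: subgroupM|rewrite mulgA].
have [h1|h1] := ltnP (len x + len c + 6 * D) (len (f * x)).
  by case: big => big; [apply: (finish c)|apply: (finish c^-1)]; rewrite //; lia.
have [h2|h2] := ltnP (len (f * x) + len c + 6 * D) (len x).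
  by case: big => big; [apply: (finish c^-1)|apply: (finish c)]; rewrite //; lia.
by exists 1; [exact: subgroup1|rewrite mulg1; split=> //; lia].
Qed.

(** One point [p] of the geodesic serves for all [g], so elements of small shift, conjugated by [p],
    lie in one ball, a finite set. *)
Lemma almost_fixed_displacement M x : almost_fixed M x ->
  exists p, forall g N, H g -> (len g <= M)%N ->
    (len (g * x) <= len x + N)%N -> (len x <= len (g * x) + N)%N ->
    (len (p^-1 * g * p) <= 2 * D + N)%N.
Proof.
move=> hx; have [p [hp shift]] := almost_fixed_shift hx.
move et: (2 * M + D).+1 => t; exists (p t) => g N Hg gM g1 g2.
have [||s1 s2] := shift g t Hg gM; [lia..|].
have [|||_ t2] := shift 1 t (subgroup1 sgH); [rewrite ?word_distxx; lia..|].
rewrite mul1g in t2; have {}t2 : (t <= len x)%N by lia.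
have -> : len ((p t)^-1 * g * p t) = d (p t) (g * p t).
  by rewrite -(inv (p t)) mulg1 -mulgA mulVKg.
have := hp _ _ s2 t2; move: s1 s2; move er: (t + _ - _)%N => r s1 _.
have := tri (p t) (p r) (g * p t); have := sym (p t) (p r).
have := sym (p r) (g * p t); have := word_normM genS g x.
have := word_normM genS g^-1 (g * x); rewrite mulKg word_normV //; lia.
Qed.

(** Letting [A] be any subgroup containing [c] allows it to be a conjugate of [H1] later. *)
Lemma elementary_cover : (forall M, exists x, almost_fixed M x) ->
  exists c, H c /\ forall A, subgroup A -> A c ->
    exists C : seq G, forall h, H h -> exists2 a, a \in C & A (a^-1 * h).
Proof.
move=> hfix.
have [[c [Hc hc]]|no] := pselect (exists c, H c /\
    forall M, exists x, almost_fixed M x /\ shifted c x).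
  exists c; split=> // A sA Ac.
  have [B hB] := word_dist_ball genS (2 * D + (len c + 6 * D)).
  apply: (bounded_index_cover (B := B)) => // F FH.
  pose M0 := (\sum_(f <- F) len f)%N.
  have [x [hx cx]] := hc (M0 + M0.+1 * len c)%N.
  have [p hp] := almost_fixed_displacement hx; exists p => f fF.
  have fM : (len f <= M0)%N by rewrite /M0 (big_rem _ fF) leq_addr.
  have := word_normM genS f x; have := word_normM genS f^-1 (f * x).
  rewrite mulKg word_normV // => f1 f2.
  have [|||e Ae [He eM e1 e2]] := shift_reduction hx Hc sA Ac cx (k := len f) (FH f fF).
  - by apply: leq_add => //; rewrite leq_mul.
  - lia.
  - lia.
  by exists e => //; apply/hB/hp => //; rewrite addnA.
(* Now each element has a small shift once [M] is large, so [H] is finite and [c = 1] will do. *)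
exists 1; split; first exact: subgroup1.
move=> A sA A1; have [B hB] := word_dist_ball genS (2 * D + 6 * D).
apply: (bounded_index_cover (B := B)) => // F FH.
have [M hM] : exists M, forall f : G, f \in F -> (len f <= M)%N /\
    forall x, almost_fixed M x -> ~ shifted f x.
  elim: F FH => [|f F IHF] FH; first by exists 0%N.
  have [|M hM] := IHF; first by move=> g gF; apply: FH; rewrite inE gF orbT.
  have [Mf hMf] : exists M, forall x, almost_fixed M x -> ~ shifted f x.
    apply: contrapT => nof; apply: no; exists f.
    split; first by apply: FH; rewrite mem_head.
    move=> M'; apply: contrapT => nox; apply: nof; exists M' => x hx sx.
    by apply: nox; exists x.
  exists (M + Mf + len f)%N => g; rewrite inE => /orP [/eqP ->|gF].
    split; first by lia.
    by move=> x hx; apply/hMf/almost_fixed_le/hx; lia.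
  have [gM hg] := hM g gF; split; first by lia.
  by move=> x hx; apply/hg/almost_fixed_le/hx; lia.
have [x hx] := hfix M; have [p hp] := almost_fixed_displacement hx.
exists p => f fF; exists 1 => //; have [fM /(_ x hx) nsh] := hM f fF.
rewrite mulg1; apply/hB/hp => //; first exact: FH.
  by rewrite leqNgt; apply/negP => ?; apply: nsh; right.
by rewrite leqNgt; apply/negP => ?; apply: nsh; left.
Qed.

End AlmostFixed.

(** * Covering [H2] by finitely many cosets of conjugates of [H1] *)

Theorem theoremA (G : groupType) (H1 H2 : set G)
    (hypG : hyperbolic G)
    (sgH1 : subgroup H1) (qcH1 : quasiconvex H1)
    (sgH2 : subgroup H2)
    (conjH : forall h : G, H2 h -> exists g : G, H1 (g^-1 * h * g)) :
  exists A : set G,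
    [/\ subgroup A, finite_index A H2 &
        exists z : G, [set z^-1 * a * z | a in A] `<=` H1].
Proof.
have [S [genS [delta /hyperbolic_four_point [D fp]]]] := hypG.
pose len := word_dist S 1; pose K b : set G := [set k | H1 (b * k * b^-1)].
have sK b : subgroup (K b) by exact: subgroup_conj.
suff [b [C cov]] : exists b (C : seq G),
    forall h : G, H2 h -> exists2 c, c \in C & K b (c^-1 * h).
  exists (H2 `&` K b); split; [exact: subgroupI|exact: finite_index_cover cov|].
  by exists b^-1 => _ [a [_ Ka] <-]; rewrite invgK.
have [hfix|] := pselect (forall M, exists x, almost_fixed S D H2 M x).
  have [c [H2c hc]] := elementary_cover genS fp sgH2 hfix.
  have [g H1g] := conjH c H2c; exists g^-1; apply: hc => //.
  by rewrite /K /= invgK.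
move=> /existsNP [M0 /forallNP nofix].
have [R [M hRM]] : exists R M, forall h : G, H2 h -> exists c,
    [/\ H2 c, (len c <= M)%N & (2 * len (h * c)%g <= len (h * c * (h * c))%g + R)%N].
  exists (20 * (M0 + D).+1 + 2 * M0 + D)%N, M0 => h Hh.
  have M0_ge0 : (len 1%g <= M0)%N by rewrite /len word_distxx.
  (* Otherwise [h^-1] is almost fixed: it has a large Gromov product with [h], and so has [c * h^-1]
     with its inverse [h / c], which is within [M0] of [h]. In [R], [2 * M0] pays for this
     replacement and [D] for the four-point inequality. *)
  apply: contrapT => no; apply: (nofix h^-1) => c Hc cM.
  have far (e : G) : H2 e -> (len e <= M0)%N ->
      (len (h * e * (h * e))%g + (20 * (M0 + D).+1 + 2 * M0 + D) < 2 * len (h * e)%g)%N.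
    by move=> He eM; rewrite ltnNge; apply/negP => le; apply: no; exists e.
  have := far 1 (subgroup1 sgH2) M0_ge0; rewrite mulg1.
  have := far c^-1 (subgroupV sgH2 Hc).
  rewrite /len (word_normV genS) => /(_ cM).
  have dVV (u : G) : word_dist S u^-1 u = word_dist S 1 (u * u).
    by rewrite -(word_distM genS u) mulgV.
  have e1 : word_dist S 1 (c * h^-1) = word_dist S 1 (h / c).
    by rewrite -(word_normV genS) invgM invgK.
  have e2 : word_dist S (h / c) (c * h^-1) = word_dist S 1 (h / c * (h / c)).
    by rewrite -dVV invgM invgK word_dist_sym.
  have e3 : word_dist S h (h / c) = word_dist S 1 c.
    by rewrite -(word_normV genS c) -[X in word_dist S X]mulg1 word_distM.
  have := word_dist_triangle genS 1 h (h / c).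
  have := word_dist_triangle genS h (h / c) (c * h^-1).
  have := word_dist_sym genS h 1; have := word_dist_sym genS (h^-1) 1.
  have := word_dist_sym genS (c * h^-1) 1.
  have := fp h^-1 h (c * h^-1) 1; have := word_dist_triangle genS 1 (h / c) h.
  rewrite dVV e1 e2 e3 (word_dist_sym genS (h / c) h) e3 (word_normV genS h).
  by rewrite -/len in cM *; lia.
have [E near] := quasiconvex_near genS fp qcH1 (R + 4 * D).
have [B hB] := word_dist_ball genS (R + 2 * D + M + E).
apply: (@neumann_cover G H2 K B [seq (x, y) | x <- B, y <- B]) => // h Hh.
have [c [Hc cM hc]] := hRM h Hh.
have B1 : 1 \in B by apply: hB; rewrite word_distxx.
have [short|long] := leqP (len (h * c)) (R + 2 * D).
  exists (h, 1) => /=; last first.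
    by split; rewrite // /K /= mulVg !mulg1 invg1 mulg1; exact: subgroup1.
  apply/allpairsP; exists (h, 1); split=> //=; apply: hB.
  have := word_normM genS (h * c) c^-1; rewrite mulgK word_normV //.
  by rewrite /len in short cM *; lia.
have [g H1g] := conjH _ (subgroupM sgH2 Hh Hc).
have [e eE H1e] := short_conjugator genS fp hc long sgH1 near H1g.
have bB : e / c \in B.
  apply: hB; have := word_normM genS e c^-1; rewrite word_normV //.
  by rewrite /len in cM; lia.
(* With [b = e / c], the element [e * (h * c) * e^-1] of [H1] equals [b * (c * h) * b^-1]. *)
exists (c^-1, e / c) => /=; last first.
  by split=> //; rewrite /K /= invgM !invgK !mulgA mulgVK in H1e *.
apply/allpairsP; exists (c^-1, e / c); split=> //=; apply: hB.
by rewrite word_normV //; rewrite /len in cM; lia.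
Qed.
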